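(* Let $k$ be a positive integer and let $P$ be a convex polygon belonging to $\mathcal{P}(k)$. Then any $n$-vertex graph in $P_{hom}$ has at most $n^k$ (inclusion-wise) maximal cliques.
   Context: All graphs are finite and nonempty. A polygon is a closed convex polygon in $\mathbb{R}^2$. $\mathcal{P}(k)$ is the family of all polygons $P$ for which there exist $k$ distinct lines through the origin such that every side of $P$ is parallel to one of these lines. For a finite collection $R$ of sets, its intersection graph has one vertex for each member of $R$, and two distinct vertices are adjacent iff the corresponding sets have nonempty intersection. $P_{hom}$ is the class of intersection graphs of finite collections of sets homothetic to $P$, i.e. sets obtained from $P$ by (positive) scaling and/or translation. *)

(* Defs.v *)
From HB Require Import structures.
From mathcomp Require Import all_boot all_order all_algebra.
From mathcomp Require Import boolp classical_sets functions cardinality.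
From mathcomp Require Import reals topology normedtype convex.

Set Implicit Arguments.
Unset Strict Implicit.
Unset Printing Implicit Defensive.

Import Order.TTheory GRing.Theory Num.Theory.
Import numFieldNormedType.Exports.

Local Open Scope classical_set_scope.
Local Open Scope ring_scope.

Record graph := Graph {
  vertex :> finType;
  adj : rel vertex;
  adj_sym : symmetric adj;
  adj_irrefl : irreflexive adj;
  vertex_gt0 : (0 < #|vertex|)%N }.

Definition clique (G : graph) (K : {set G}) : bool :=
  [forall u in K, forall v in K, (u != v) ==> adj u v].

Definition maximal_cliques (G : graph) : {set {set G}} :=
  finset (maxset (@clique G)).

Section Polygons.
Variable R : realType.
Local Notation plane := 'rV[R]_2.

Definition convex_hull (A : set plane) : set plane := smallest (@convex_set R plane) A.

(* The interior condition excludes points and segments. *)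
Definition polygon (P : set plane) : Prop :=
  (exists2 V : set plane, finite_set V & P = convex_hull V) /\ P° !=set0.

(* [S] is the face of [P] cut out by a supporting line, and it is not reduced
   to a vertex. *)
Definition side (P S : set plane) : Prop :=
  exists (u : 'cV[R]_2) (c : R),
    [/\ u != 0,
        P `<=` [set x | (x *m u) 0 0 <= c],
        S = P `&` [set x | (x *m u) 0 0 = c]
      & exists x y, [/\ S x, S y & x != y]].

Definition parallel (S : set plane) (l : {vspace plane}) : Prop :=
  forall x y, S x -> S y -> y - x \in l.

(* Lines through the origin are the one-dimensional vector subspaces. *)
Definition polygon_dir (k : nat) (P : set plane) : Prop :=
  polygon P /\
  exists l : 'I_k -> {vspace plane},
    [/\ injective l,
        forall i, \dim (l i) = 1%N
      & forall S, side P S -> exists i, parallel S (l i)].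

Definition homothetic (P Q : set plane) : Prop :=
  exists (a : R) (t : plane), 0 < a /\ Q = [set a *: x + t | x in P].

(* [F] lists the members of the collection, possibly with repetitions, indexed
   by the vertices they are represented by. *)
Definition intersection_graph (T : Type) (G : graph) (F : G -> set T) : Prop :=
  forall u v : G, u != v -> adj u v <-> F u `&` F v !=set0.

Definition hom_graph (P : set plane) (G : graph) : Prop :=
  exists F : G -> set plane,
    (forall v, homothetic P (F v)) /\ intersection_graph F.

End Polygons.

(* Main.v *)
(* If two homothets of [P] are disjoint, Gordan's theorem applied to the
   differences of their vertices gives a direction [u] separating them strictly.
   Turning [u] until the closest pair of vertices is no longer unique makes it
   normal to a side of [P] while it still separates. So two homothets meet iff
   their projections meet in each of the [k] directions normal to the given
   lines, and the graph is an intersection graph of boxes in [R^k]. *)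
Require Import Defs.
From mathcomp Require Import all_boot all_order all_algebra.
From mathcomp Require Import boolp classical_sets cardinality.
From mathcomp Require Import reals topology normedtype convex.
From mathcomp Require Import interval_inference ring lra.

Set Implicit Arguments.
Unset Strict Implicit.
Unset Printing Implicit Defensive.

Import Order.TTheory GRing.Theory Num.Theory.
Import numFieldNormedType.Exports.

Local Open Scope classical_set_scope.
Local Open Scope ring_scope.

(** * Pairing of row vectors with linear forms *)

Definition dot (R : realType) (m : nat) (x : 'rV[R]_m) (u : 'cV[R]_m) : R :=
  (x *m u) 0 0.

Lemma dotDl (R : realType) m (x y : 'rV[R]_m) u : dot (x + y) u = dot x u + dot y u.
Proof. by rewrite /dot mulmxDl mxE. Qed.

Lemma dotBl (R : realType) m (x y : 'rV[R]_m) u : dot (x - y) u = dot x u - dot y u.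
Proof. by rewrite /dot mulmxBl !mxE. Qed.

Lemma dotZl (R : realType) m a (x : 'rV[R]_m) u : dot (a *: x) u = a * dot x u.
Proof. by rewrite /dot -scalemxAl mxE. Qed.

Lemma dotDr (R : realType) m (x : 'rV[R]_m) u v : dot x (u + v) = dot x u + dot x v.
Proof. by rewrite /dot mulmxDr mxE. Qed.

Lemma dotNr (R : realType) m (x : 'rV[R]_m) u : dot x (- u) = - dot x u.
Proof. by rewrite /dot mulmxN mxE. Qed.

Lemma dotZr (R : realType) m a (x : 'rV[R]_m) u : dot x (a *: u) = a * dot x u.
Proof. by rewrite /dot -scalemxAr mxE. Qed.

Lemma dotr0 (R : realType) m (x : 'rV[R]_m) : dot x 0 = 0.
Proof. by rewrite /dot mulmx0 mxE. Qed.

Definition dotE := (dotBl, dotDl, dotZl, dotDr, dotNr, dotZr).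

Lemma dot_tr_gt0 (R : realType) m (x : 'rV[R]_m) : x != 0 -> 0 < dot x x^T.
Proof.
have dotxx : dot x x^T = \sum_j x 0 j ^+ 2.
  by rewrite /dot mxE; apply: eq_bigr => j _; rewrite mxE expr2.
rewrite dotxx lt_neqAle sumr_ge0 ?andbT => [|j _]; last exact: sqr_ge0.
apply: contra_neq => /esym s0; apply/rowP => j; rewrite mxE; apply/eqP.
rewrite -sqrf_eq0; apply/eqP/(psumr_eq0P _ s0) => // i _; exact: sqr_ge0.
Qed.

(** * Finite systems of strict inequalities *)

Lemma seq_argmax (R : realType) (T : eqType) (f : T -> R) (s : seq T) (x0 : T) :
  x0 \in s -> exists2 x, x \in s & {in s, forall y, f y <= f x}.
Proof.
elim: s x0 => [//|a [|b s] IH] x0 _.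
  by exists a; rewrite ?mem_head // => y; rewrite inE => /eqP ->.
have [x xs fx] := IH b (mem_head _ _).
have [le_ax|lt_xa] := leP (f a) (f x).
  exists x; first by rewrite in_cons xs orbT.
  by move=> y /predU1P[->//|/fx].
exists a; first exact: mem_head.
by move=> y /predU1P[->//|/fx/le_trans]; apply; exact: ltW.
Qed.

(** Shrinking [e] keeps the inequalities already secured: for [0 < e' <= e], the value
    [f x + e' * g x] lies between [f x] and [f x + e * g x]. *)
Lemma seq_perturb (R : realType) (T : eqType) (s : seq T) (f g : T -> R) :
  {in s, forall x, f x < 0} ->
  exists2 e : R, 0 < e & {in s, forall x, f x + e * g x < 0}.
Proof.
elim: s => [|a s IH] fs; first by exists 1.
have [x xs|e e0 es] := IH; first by apply: fs; rewrite in_cons xs orbT.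
have fa := fs _ (mem_head a s).
have g1 : 0 < `|g a| + 1 by rewrite ltr_wpDl.
(* This gives [r * |g a| < - f a]; the [+ 1] keeps the denominator positive when [g a = 0]. *)
pose r := - f a / (`|g a| + 1) / 2.
have r0 : 0 < r by rewrite /r !divr_gt0 // oppr_gt0.
have rE : r * (`|g a| + 1) = - f a / 2 by rewrite /r; field; rewrite gt_eqF.
exists (Num.min e r); first by rewrite lt_min e0.
have e'0 : 0 < Num.min e r by rewrite lt_min e0.
have e'e : Num.min e r <= e by rewrite ge_min lexx.
have e'r : Num.min e r <= r by rewrite ge_min lexx orbT.
move: (Num.min e r) e'0 e'e e'r => e' e'0 e'e e'r x.
rewrite in_cons => /predU1P[->|xs].
  have ? := ler_norm (g a); have ? := normr_ge0 (g a).
  have ? : e' * g a <= r * `|g a|.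
    by rewrite (le_trans (ler_wpM2l (ltW e'0) (ler_norm _)))// ler_wpM2r.
  nra.
have fx : f x < 0 by apply: fs; rewrite in_cons xs orbT.
have := es x xs; nra.
Qed.

(* Gordan's theorem of the alternative, with the convex cone generated by [Z]
   replaced by any convex cone containing it. *)
Lemma gordan (R : realType) m (C : set 'rV[R]_m)
    (CD : forall x y, C x -> C y -> C (x + y))
    (CZ : forall (a : R) x, 0 < a -> C x -> C (a *: x))
    (C0 : ~ C 0) (Z : seq 'rV[R]_m) :
  {in Z, forall z, C z} -> exists u, {in Z, forall z, dot z u < 0}.
Proof.
(* Induction on a bound for the size, as the hypothesis serves for the tail [Z] and again for its
   projections. *)
have [p] := ubnP (size Z); elim: p Z => [//|p IH] [_ _|z0 Z]; first by exists 0.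
rewrite /= ltnS => szZ CZ0.
have Cz0 : C z0 by apply: CZ0; exact: mem_head.
have CzZ z : z \in Z -> C z by move=> zZ; apply: CZ0; rewrite in_cons zZ orbT.
have [u uZ] := IH Z szZ CzZ.
have [uz0|uz0] := leP 0 (dot z0 u); last first.
  by exists u => z; rewrite in_cons => /predU1P[->|/uZ].
(* A form that vanishes at [z0] and is negative on [Z] can be perturbed slightly to become negative
   at [z0] too. *)
suff [u1 [u2 [u1z0 u2z0 u1Z]]] : exists u1 u2,
    [/\ dot z0 u1 = 0, dot z0 u2 < 0 & {in Z, forall z, dot z u1 < 0}].
  have [e e0 eZ] := seq_perturb (fun z => dot z u2) u1Z.
  exists (u1 + e *: u2) => z; rewrite in_cons => /predU1P[->|/eZ]; rewrite !dotE //.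
  by rewrite u1z0 add0r pmulr_rlt0.
move: uz0; rewrite le_eqVlt => /predU1P[/esym uz0|uz0].
  exists u, (- z0^T); split=> //; rewrite dotNr oppr_lt0 dot_tr_gt0 //.
  by apply/eqP => z00; apply: C0; rewrite -z00.
(* The projections of the other vectors along [z0] onto the kernel of [u]. *)
pose pr z := dot z0 u *: z + (- dot z u) *: z0.
have [|z /mapP[y yZ ->]|u' u'Z] := IH [seq pr z | z <- Z].
- by rewrite size_map.
- by apply: CD; apply: CZ; rewrite ?oppr_gt0 ?uZ //; exact: CzZ.
(* The first witness is the form sending [z] to [dot (pr z) u']; it vanishes at [z0] because
   [pr z0 = 0]. *)
exists (dot z0 u *: u' - dot z0 u' *: u), (- u); split.
- by rewrite !dotE; ring.
- by rewrite dotNr oppr_lt0.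
by move=> z zZ; have := u'Z _ (map_f pr zZ); rewrite /pr !dotE; lra.
Qed.

(** * Orthogonality and turning directions in the plane *)

(** The counterclockwise quarter turn, written as a column so that it acts as a linear form. *)
Definition rot (R : realType) (x : 'rV[R]_2) : 'cV[R]_2 :=
  \col_j (if j == 0 then - x 0 1 else x 0 0).

Lemma dot2E (R : realType) (x : 'rV[R]_2) u : dot x u = x 0 0 * u 0 0 + x 0 1 * u 1 0.
Proof.
by rewrite /dot mxE big_ord_recl big_ord1 (_ : lift ord0 ord0 = 1) //; exact/val_inj.
Qed.

Lemma dot_rot (R : realType) (x : 'rV[R]_2) : dot x (rot x) = 0.
Proof. by rewrite dot2E !mxE /=; ring. Qed.

Lemma row2P (R : realType) (x y : 'rV[R]_2) : x 0 0 = y 0 0 -> x 0 1 = y 0 1 -> x = y.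
Proof.
move=> x0 x1; apply/rowP => -[[|[|//]] j2].
- by rewrite (_ : Ordinal j2 = 0) //; apply/val_inj.
- by rewrite (_ : Ordinal j2 = 1) //; apply/val_inj.
Qed.

Lemma col2P (R : realType) (x y : 'cV[R]_2) : x 0 0 = y 0 0 -> x 1 0 = y 1 0 -> x = y.
Proof. by move=> x0 x1; apply/trmx_inj/row2P; rewrite !mxE. Qed.

Lemma dot_eq0_rot (R : realType) (x : 'rV[R]_2) (u : 'cV[R]_2) :
  x != 0 -> dot x u = 0 -> exists c, u = c *: rot x.
Proof.
move=> /dot_tr_gt0 + xu; move: xu; rewrite !dot2E !mxE => xu x0.
(* The coefficient of the orthogonal projection of [u] onto [rot x]. *)
exists ((u 1 0 * x 0 0 - u 0 0 * x 0 1) / (x 0 0 * x 0 0 + x 0 1 * x 0 1)).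
have {}x0 := lt0r_neq0 x0.
have xu0 y : y * (x 0 0 * u 0 0 + x 0 1 * u 1 0) = 0 by rewrite xu mulr0.
apply: col2P; rewrite !mxE /= mulrAC; apply: (canRL (mulfK x0)).
  by have := xu0 (x 0 0); lra.
by have := xu0 (x 0 1); lra.
Qed.

Lemma rot_neq0 (R : realType) (x : 'rV[R]_2) : x != 0 -> rot x != 0.
Proof.
apply: contra_neq => /colP x0; apply: row2P; rewrite mxE.
  by have := x0 1; rewrite !mxE.
by have := x0 0; rewrite !mxE /=; lra.
Qed.

(** The form [u0] turns in a direction orthogonal to its leading element [z1] until the first other
    element catches up. The spanning hypothesis ensures that some element does. *)
Lemma rotate_to_tie (R : realType) (Z : seq 'rV[R]_2) (u0 : 'cV[R]_2) :
    {in Z, forall z, dot z u0 < 0} ->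
    (forall d : 'cV[R]_2, d != 0 -> exists2 z, z \in Z & dot z d != 0) ->
  exists u z1 z2, [/\ z1 \in Z, z2 \in Z, z1 != z2, dot z1 u < 0 &
    dot z2 u = dot z1 u /\ {in Z, forall z, dot z u <= dot z1 u}].
Proof.
move=> u0Z Zspan.
have [z0 z0Z _] : exists2 z, z \in Z & dot z (const_mx 1) != 0.
  apply: Zspan; apply/eqP => /colP/(_ 0); rewrite !mxE => /eqP.
  by rewrite oner_eq0.
have [z1 z1Z z1max] := seq_argmax (fun z => dot z u0) z0Z.
have z1_neq0 : z1 != 0.
  by apply: contraTneq (u0Z _ z1Z) => ->; rewrite /dot mul0mx mxE ltxx.
(* Some element of [Z] is not orthogonal to [rot z1]; its sign there selects one of the two opposite
   quarter turns. *)
have [d dz1 [y yZ yd]] : exists2 d, dot z1 d = 0 & exists2 z, z \in Z & 0 < dot z d.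
  have [z zZ] := Zspan _ (rot_neq0 z1_neq0).
  rewrite neq_lt => /orP[] zd; [exists (- rot z1)|exists (rot z1)];
    rewrite ?dotNr ?dot_rot ?oppr0 //; exists z => //.
  by rewrite dotNr oppr_gt0.
(* [tau z] is the time at which [z] catches up with [z1] as [u0] turns towards
   [d]; the value at [z1] does not change in the meantime. *)
pose tau z := (dot z1 u0 - dot z u0) / dot z d.
pose Zd := [seq z <- Z | 0 < dot z d].
have yZd : y \in Zd by rewrite mem_filter yd.
have [z2] := seq_argmax (fun z => - tau z) yZd.
rewrite mem_filter => /andP[z2d z2Z] z2min.
have tau0 : 0 <= tau z2 by apply: divr_ge0; [rewrite subr_ge0 z1max|exact: ltW].
exists (u0 + tau z2 *: d), z1, z2; split=> //.
- by apply: contraTneq z2d => <-; rewrite dz1 ltxx.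
- by rewrite !dotE dz1 mulr0 addr0 u0Z.
split=> [|z zZ]; rewrite !dotE dz1 mulr0 addr0.
  by rewrite /tau divfK ?gt_eqF //; ring.
(* Elements with [dot z d <= 0] never gain on [z1]; the others reach it no earlier than [z2]. *)
have [zd|zd] := leP (dot z d) 0.
  by rewrite -[leRHS]addr0 lerD ?z1max// mulr_ge0_le0.
have zZd : z \in Zd by rewrite mem_filter zd.
have := z2min _ zZd; rewrite lerN2 => le_tau.
by rewrite addrC -lerBrDr -ler_pdivlMr.
Qed.

(** * Convex hulls and separation of homothets *)

Lemma convex_set_comb (R : realType) (E : lmodType R) (A : set E) (r : R) (x y : E) :
  convex_set A -> 0 <= r <= 1 -> A x -> A y -> A (r *: x + (1 - r) *: y).
Proof.
move=> cA /andP[r0 r1] Ax Ay.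
by have := cA x y (Itv01 r0 r1) (mem_set Ax) (mem_set Ay); rewrite inE.
Qed.

Lemma convex_hull_convex (R : realType) (V : set 'rV[R]_2) : convex_set (convex_hull V).
Proof.
move=> x y r; rewrite !inE => Vx Vy A cVA; apply/set_mem/cVA.1.
  by apply/mem_set; exact: Vx.
by apply/mem_set; exact: Vy.
Qed.

Lemma convex_hull_neq0 (R : realType) (V : set 'rV[R]_2) x :
  convex_hull V x -> V !=set0.
Proof.
have [->|/set0P//] := eqVneq V set0.
by move=> /(_ set0)[]; split=> // y z r; rewrite inE.
Qed.

Lemma convex_hull_le (R : realType) (V : set 'rV[R]_2) u c :
  (forall v, V v -> dot v u <= c) -> forall x, convex_hull V x -> dot x u <= c.
Proof.
move=> Vc; apply: (@smallest_sub _ _ _ [set x | dot x u <= c]) => // x y r.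
rewrite !inE /= => xc yc.
have r0 : 0 <= r%:num by []; have r1 : r%:num <= 1 by [].
rewrite -[conv r x y]/(r%:num *: x + (1 - r%:num) *: y) !dotE.
by move: r%:num r0 r1 => q; nra.
Qed.

(** Moving from [x] along [d^T] increases the form [d], and a short enough move stays in a ball
    contained in [P]. *)
Lemma interior_dot_lt (R : realType) (P : set 'rV[R]_2) x (d : 'cV[R]_2) :
  P° x -> d != 0 -> exists2 y, P y & dot x d < dot y d.
Proof.
move=> /nbhs_normP[e /= e0 eP] d0.
have dT0 : d^T != 0 by rewrite trmx_eq0.
have nd0 : 0 < `|d^T| by rewrite normr_gt0.
pose r := e / 2 / `|d^T|.
have r0 : 0 < r by rewrite /r !divr_gt0.
exists (x + r *: d^T).
  apply: eP => /=; rewrite opprD addrA subrr add0r normrN normrZ gtr0_norm//.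
  by rewrite divfK ?gt_eqF //; lra.
by rewrite !dotE ltrDl mulr_gt0// -{2}(trmxK d) dot_tr_gt0.
Qed.

(** The tie is between two distinct differences of vertices, so the two pairs differ in their first
    or in their second members. The edge found is accordingly maximal or minimal for [u], whence the
    disjunction. *)
Lemma homothets_separated (R : realType) (V : seq 'rV[R]_2) (a b : R) (s t : 'rV[R]_2)
    (P := convex_hull [set` V]) :
    P° !=set0 -> 0 < a -> 0 < b ->
    (forall x y, P x -> P y -> a *: x + t != b *: y + s) ->
  exists u x1 x2, [/\ P x1, P x2, x1 != x2, dot x1 u = dot x2 u &
    ((forall x, P x -> dot x u <= dot x1 u) \/ (forall x, P x -> dot x1 u <= dot x u)) /\
    forall x y, P x -> P y -> dot (a *: x + t) u < dot (b *: y + s) u].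
Proof.
move=> [o Po] a0 b0 disj; pose df x y := (a *: x + t) - (b *: y + s).
have VP v : v \in V -> P v by move=> vV A [_]; exact.
(* The cone over the difference of the two homothets: convex because [P] is, and without 0 because
   they are disjoint. *)
pose C : set 'rV[R]_2 := [set z | exists r x y, [/\ 0 < r, P x, P y & z = r *: df x y]].
have CD z z' : C z -> C z' -> C (z + z').
  move=> [r [x [y [r0 Px Py ->]]]] [r' [x' [y' [r'0 Px' Py' ->]]]].
  have rr'0 : 0 < r + r' by exact: addr_gt0.
  pose p := r / (r + r').
  have p01 : 0 <= p <= 1.
    by rewrite /p divr_ge0 ?(ltW r0) ?(ltW rr'0) //= ler_pdivrMr // mul1r lerDl (ltW r'0).
  exists (r + r'), (p *: x + (1 - p) *: x'), (p *: y + (1 - p) *: y'); split=> //.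
  - exact: convex_set_comb (@convex_hull_convex _ _) _ _ _.
  - exact: convex_set_comb (@convex_hull_convex _ _) _ _ _.
  by apply: row2P; rewrite /df /p !mxE; field; rewrite gt_eqF.
have CZ c z : 0 < c -> C z -> C (c *: z).
  move=> c0 [r [x [y [r0 Px Py ->]]]]; exists (c * r), x, y.
  by rewrite scalerA mulr_gt0.
have C0 : ~ C 0.
  move=> [r [x [y [r0 Px Py /esym/eqP]]]].
  by rewrite scaler_eq0 gt_eqF //= subr_eq0 (negbTE (disj _ _ _ _)).
pose Z := [seq df x y | x <- V, y <- V].
have ZC : {in Z, forall z, C z}.
  move=> _ /allpairsP[[x y] /= [xV yV ->]]; exists 1, x, y.
  by rewrite scale1r; split=> //; exact: VP.
have [u0 u0Z] := gordan CD CZ C0 ZC.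
have [v0 v0V] := convex_hull_neq0 (interior_subset Po).
(* A form vanishing on all of [Z] would be constant on [V], hence on [P], contradicting the interior
   point. *)
have Zspan d : d != 0 -> exists2 z, z \in Z & dot z d != 0.
  move=> d0; apply/hasP; apply: contraT => /hasPn Zd.
  have Vd v : v \in V -> dot v d = dot v0 d.
    move=> vV; have := Zd _ (allpairs_f df vV v0V).
    have := Zd _ (allpairs_f df v0V v0V).
    rewrite !negbK !dotE => /eqP e1 /eqP e2; apply: (mulfI (lt0r_neq0 a0)); lra.
  have [y Py] := interior_dot_lt Po d0.
  have := @convex_hull_le _ [set` V] d (dot v0 d) _ y Py.
  have := @convex_hull_le _ [set` V] (- d) (- dot v0 d) _ o (interior_subset Po).
  rewrite dotNr => h1 h2.
  have {}h1 : - dot o d <= - dot v0 d by apply: h1 => v /Vd; rewrite dotNr => ->.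
  have {}h2 : dot y d <= dot v0 d by apply: h2 => v /Vd ->.
  lra.
have [u [z1 [z2 [/allpairsP[[v1 w1] /= [v1V w1V ->]] /allpairsP[[v2 w2] /= [v2V w2V ->]]]]]]
  := rotate_to_tie u0Z Zspan.
move=> z12 z1u [z12u Zu].
(* Fixing one member of the maximal pair [v1], [w1] and varying the other makes each extremal
   separately. *)
have u_max x : P x -> dot x u <= dot v1 u.
  apply: convex_hull_le => v vV; rewrite -(ler_pM2l a0).
  by have := Zu _ (allpairs_f df vV w1V); rewrite !dotE; lra.
have u_min x : P x -> dot w1 u <= dot x u.
  rewrite -lerN2 -!dotNr; apply: convex_hull_le => v vV.
  rewrite !dotNr -(ler_pM2l b0).
  by have := Zu _ (allpairs_f df v1V vV); rewrite !dotE; lra.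
have sep x y : P x -> P y -> dot (a *: x + t) u < dot (b *: y + s) u.
  move=> /u_max; rewrite -(ler_pM2l a0) => xu /u_min; rewrite -(ler_pM2l b0).
  by move: z1u; rewrite !dotE; lra.
(* With the tie, these two inequalities force [u] to agree on [v1] and [v2], and on [w1] and
   [w2]. *)
have v2u := u_max _ (VP _ v2V); have w2u := u_min _ (VP _ w2V).
have [v12|v12] := eqVneq v1 v2.
  have w12 : w1 != w2 by apply: contra_neq z12 => ->; rewrite v12.
  exists u, w1, w2; split=> //; [exact: VP|exact: VP| |by split=> //; right].
  by apply: (mulfI (lt0r_neq0 b0)); move: z12u; rewrite v12 !dotE; lra.
exists u, v1, v2; split=> //; [exact: VP|exact: VP| |by split=> //; left].
apply: (mulfI (lt0r_neq0 a0)); move: z12u; rewrite !dotE.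
by move: v2u w2u; rewrite -(ler_pM2l a0) => v2u; rewrite -(ler_pM2l b0); lra.
Qed.

(** * Counting maximal cliques in intersection graphs of boxes *)

(* Boxes have the Helly property: if the boxes of a clique pairwise meet, they
   all contain the point whose [i]-th coordinate is the largest of their left
   ends, and this point is described by a [k]-tuple of vertices. *)
Lemma card_maximal_cliques_boxes (R : realType) (G : graph) (k : nat)
    (lo hi : 'I_k -> G -> R) :
    (forall i v, lo i v <= hi i v) ->
    (forall u v, u != v -> adj u v <-> forall i, lo i u <= hi i v /\ lo i v <= hi i u) ->
  (#|maximal_cliques G| <= #|G| ^ k)%N.
Proof.
move=> lohi adjE.
(* The vertices whose boxes contain the point with [i]-th coordinate [lo i (f i)]. *)
pose C (f : {ffun 'I_k -> G}) : {set G} :=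
  finset (fun v => [forall i, lo i v <= lo i (f i) <= hi i v]).
have C_clique f : clique (C f).
  apply/forall_inP => u; rewrite inE => /forallP uC.
  apply/forall_inP => v; rewrite inE => /forallP vC.
  apply/implyP => /adjE[_]; apply => i.
  have /andP[u1 u2] := uC i; have /andP[v1 v2] := vC i.
  by split; [exact: le_trans v2|exact: le_trans u2].
have [x0 _] := card_gt0P (vertex_gt0 G).
rewrite -[k in leqRHS]card_ord -card_ffun.
(* It remains to write every maximal clique as some [C f]. *)
apply: leq_trans (leq_imset_card C predT); apply/subset_leq_card/fintype.subsetP => K.
rewrite inE => /maxsetP[Kcl Kmax].
(* The [arg max] below needs a member of [K]; the empty clique is not maximal, since a singleton
   extends it. *)
have [x xK] : exists x, x \in K.
  apply/set0Pn; apply/eqP => K0.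
  have : finset.set1 x0 = K.
    apply: Kmax; last by rewrite K0 finset.sub0set.
    apply/forall_inP => u /set1P->; apply/forall_inP => v /set1P->.
    by rewrite eqxx.
  by move/setP/(_ x0); rewrite K0 !inE eqxx.
pose f : {ffun 'I_k -> G} := [ffun i => [arg max_(v > x in K) lo i v]%O].
apply/imsetP; exists f => //; apply/esym/Kmax; first exact: C_clique.
apply/fintype.subsetP => v vK; rewrite inE; apply/forallP => i.
rewrite ffunE; case: arg_maxP => // w wK wmax; apply/andP; split; first exact: wmax.
have [->//|wv] := eqVneq w v.
have /forall_inP/(_ w wK)/forall_inP/(_ v vK)/implyP/(_ wv) := Kcl.
by move=> /(adjE _ _ wv)/(_ i)[].
Qed.

(** * From homothets to boxes *)

Theorem corollary1 (R : realType) (k : nat) (hk : (0 < k)%N)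
    (P : set 'rV[R]_2) (hP : polygon_dir k P)
    (n : nat) (G : graph) (hn : #|G| = n) (hG : hom_graph P G) :
  (#|maximal_cliques G| <= n ^ k)%N.
Proof.
rewrite -hn; case: hP => -[[_ /finite_seqP[V ->] PE] P0] [l [_ ldim lside]].
subst P; set P := convex_hull _ in P0 lside hG.
case: hG => F [/choice[a /choice[t Fat]] adjF].
have [o Po] := P0; have {}Po := interior_subset Po.
have VP v : v \in V -> P v by move=> vV A [_]; exact.
have Pmax (u : 'cV[R]_2) : exists2 x, P x & forall y, P y -> dot y u <= dot x u.
  have [v0 v0V] := convex_hull_neq0 Po.
  have [v vV vmax] := seq_argmax (fun z => dot z u) v0V.
  by exists v; [exact: VP|exact: convex_hull_le].
(* A normal to the line [l i], which is spanned by its nonzero element [vpick (l i)]. *)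
pose e i := rot (vpick (l i)).
have /choice[pM pMP] i : exists x, P x /\ forall y, P y -> dot y (e i) <= dot x (e i).
  by have [x] := Pmax (e i); exists x.
have /choice[pm pmP] i : exists x, P x /\ forall y, P y -> dot x (e i) <= dot y (e i).
  by have [x Px xmax] := Pmax (- e i); exists x; split=> // y /xmax; rewrite !dotNr lerN2.
(* The ends of the projection of [F v] along [e i]; positive scaling preserves which points of [P]
   are extremal. *)
pose lo i v := dot (a v *: pm i + t v) (e i).
pose hi i v := dot (a v *: pM i + t v) (e i).
have lo_le i v x : P x -> lo i v <= dot (a v *: x + t v) (e i).
  by move=> Px; rewrite /lo !dotE lerD2r ler_pM2l ?(Fat v).1// (pmP i).2.
have le_hi i v x : P x -> dot (a v *: x + t v) (e i) <= hi i v.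
  by move=> Px; rewrite /hi !dotE lerD2r ler_pM2l ?(Fat v).1// (pMP i).2.
apply: (@card_maximal_cliques_boxes _ _ _ lo hi) => [i v|u v uv].
  exact: le_trans (lo_le _ _ _ Po) (le_hi _ _ _ Po).
rewrite adjF // (Fat u).2 (Fat v).2; split=> [[_ [[x Px <-] [y Py xy]]] i|lohi].
  split; first by apply: le_trans (lo_le _ _ _ Px) _; rewrite -xy le_hi.
  by apply: le_trans (lo_le _ _ _ Py) _; rewrite xy le_hi.
apply: contrapT => disj.
have [|w [x1 [x2 [Px1 Px2 x12 x12w [supp sep]]]]] :=
  @homothets_separated _ V (a u) (a v) (t v) (t u) P0 (Fat u).1 (Fat v).1.
  move=> x y Px Py; apply/eqP => xy; apply: disj; exists (a u *: x + t u).
  by split; [exists x|exists y].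
have w0 : w != 0 by apply: contraTneq (sep _ _ Po Po) => ->; rewrite !dotr0 ltxx.
have [i x12l] : exists i, x2 - x1 \in l i.
  (* A side needs an outer normal: [w] if the edge is maximal for [w], and [- w] if it is
     minimal. *)
  have [z [wz Sz]] : exists z, [/\ z = w \/ z = - w &
      side P (P `&` [set x | dot x z = dot x1 z])].
    case: supp => supp; [exists w|exists (- w)]; split; auto.
      by exists w, (dot x1 w); split=> //; exists x1, x2.
    exists (- w), (dot x1 (- w)); split=> //; first by rewrite oppr_eq0.
      by move=> x /supp /=; rewrite -[(_ *m _) 0 0]/(dot _ _) !dotNr lerN2.
    by exists x1, x2; split=> //; split=> //=; rewrite !dotNr x12w.
  have [i Pi] := lside _ Sz; exists i; apply: Pi => //; split=> //=.
  by case: wz => ->; rewrite ?dotNr x12w.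
have [c wE] : exists c, w = c *: e i.
  apply: dot_eq0_rot; first by rewrite vpick0 -dimv_eq0 ldim.
  have l_line : l i = <[vpick (l i)]>%VS.
    apply/esym/eqP; rewrite -dimv_leqif_eq -?memvE ?memv_pick //.
    by rewrite dim_vline ldim vpick0 -dimv_eq0 ldim.
  rewrite l_line in x12l; have [b x12b] := vlineP _ _ x12l.
  have b0 : b != 0.
    by apply: contra_neq x12 => b0; apply/esym/subr0_eq; rewrite x12b b0 scale0r.
  by apply: (mulfI b0); rewrite -dotZl -x12b dotBl x12w subrr mulr0.
(* The sign of [c] is unknown: the first instance of [sep] contradicts overlap in direction [i] when
   [c > 0], the second when [c < 0], and either is absurd when [c = 0]. *)
have := sep _ _ (pMP i).1 (pmP i).1; have := sep _ _ (pmP i).1 (pMP i).1.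
have [] := lohi i; rewrite wE !(dotZr c) -/(lo i u) -/(lo i v) -/(hi i u) -/(hi i v).
by have [c0|c0|->] := ltgtP c 0; nra.
Qed.
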